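(* Let $n,k,\ell$ be positive integers, and let $\Gamma=\mathrm{Cay}(\mathbb{Z}_n,\{x^k,x^{-k},x^\ell,x^{-\ell}\})$ be a connected circulant quartic graph. Then $\Gamma$ contains no $(1,4)$-regular set.
   Context: $\mathbb{Z}_n=\langle x\rangle$ denotes the cyclic group of order $n$, written multiplicatively. For a finite group $G$ with identity $e$ and an inverse-closed subset $S\subseteq G\setminus\{e\}$, the Cayley graph $\mathrm{Cay}(G,S)$ is the simple graph with vertex set $G$ in which $y$ and $z$ are adjacent if and only if $y^{-1}z\in S$. A circulant quartic graph is a graph $\mathrm{Cay}(\mathbb{Z}_n,\{x^k,x^{-k},x^\ell,x^{-\ell}\})$ where $x^k,x^{-k},x^\ell,x^{-\ell}$ are four distinct non-identity elements. For a graph $\Gamma$ and nonnegative integers $a,b$, a nonempty proper subset $C$ of $V(\Gamma)$ is an $(a,b)$-regular set of $\Gamma$ if every vertex in $C$ has exactly $a$ neighbours in $C$ and every vertex in $V(\Gamma)\setminus C$ has exactly $b$ neighbours in $C$. *)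

(* Defs.v *)
From mathcomp Require Import all_boot all_fingroup.

Set Implicit Arguments.
Unset Strict Implicit.
Unset Printing Implicit Defensive.

Import GroupScope.

(* A simple graph on the finite type T is a symmetric irreflexive e : rel T. *)

Definition neighbours (T : finType) (e : rel T) (v : T) : {set T} :=
  [set w | e v w].

Definition connected_graph (T : finType) (e : rel T) : Prop :=
  forall y z : T, connect e y z.

Definition regular_set (T : finType) (e : rel T) (a b : nat) (C : {set T}) :
    Prop :=
  [/\ C != set0,
      C \proper [set: T],
      forall v, v \in C -> #|neighbours e v :&: C| = a
    & forall v, v \notin C -> #|neighbours e v :&: C| = b].

(* The Cayley graph with vertex set gT, as an adjacency relation; it is a     *)
(* simple graph when S is inverse-closed and omits 1 (Cay_sym, Cay_irr).      *)
Definition Cay (gT : finGroupType) (S : {set gT}) : rel gT :=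
  [rel y z | y^-1 * z \in S].

Lemma Cay_sym (gT : finGroupType) (S : {set gT}) :
  (forall s, s \in S -> s^-1 \in S) -> symmetric (Cay S).
Proof.
have half y z : (forall s, s \in S -> s^-1 \in S) -> Cay S y z -> Cay S z y.
  by move=> SV; rewrite /Cay /= => /SV; rewrite invMg invgK.
by move=> SV y z; apply/idP/idP; apply: half.
Qed.

Lemma Cay_irr (gT : finGroupType) (S : {set gT}) :
  1 \notin S -> irreflexive (Cay S).
Proof. by move=> S1 y; rewrite /Cay /= mulVg; apply: negbTE. Qed.

Definition circ_set (gT : finGroupType) (x : gT) (k l : nat) : {set gT} :=
  [set x ^+ k; x ^- k; x ^+ l; x ^- l].

Definition circ_quartic (gT : finGroupType) (x : gT) (k l : nat) : bool :=
  uniq [:: 1; x ^+ k; x ^- k; x ^+ l; x ^- l].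

Lemma circ_set_inv (gT : finGroupType) (x : gT) (k l : nat) s :
  s \in circ_set x k l -> s^-1 \in circ_set x k l.
Proof.
rewrite !inE -!orbA => /or4P[] /eqP->; by rewrite ?invgK eqxx ?orbT.
Qed.

Lemma circ_set1 (gT : finGroupType) (x : gT) (k l : nat) :
  circ_quartic x k l -> 1 \notin circ_set x k l.
Proof. by rewrite /circ_quartic cons_uniq !inE -!orbA => /andP[]. Qed.

(* Main.v *)
Require Import Defs.
From mathcomp Require Import all_boot all_fingroup.

Set Implicit Arguments.
Unset Strict Implicit.
Unset Printing Implicit Defensive.

Import GroupScope.

(** The graph is too full of squares to carry such a set [C].  As the degree
    is 4, every neighbour of a vertex outside [C] lies in [C], so two vertices
    outside [C] are never adjacent.  As [C] is nonempty, it contains some edge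
    from [v] to [v * s].  Choose a generator [t] other than [s] and [s^-1].
    Since the group is abelian, [v], [v * s], [v * s * t], [v * t] is a 4-cycle.
    Its first two vertices are each other's only neighbour in [C], so the other
    two are adjacent vertices outside [C], a contradiction
    ([no_matched_edge_in_square]). *)

Lemma neighbours_Cay (gT : finGroupType) (S : {set gT}) (v s : gT) :
  (v * s \in neighbours (Cay S) v) = (s \in S).
Proof. by rewrite inE /Cay /= mulKg. Qed.

Lemma card_neighbours_Cay (gT : finGroupType) (S : {set gT}) (v : gT) :
  #|neighbours (Cay S) v| = #|S|.
Proof.
rewrite -(card_lcoset S v); apply: eq_card => w.
by rewrite mem_lcoset inE.
Qed.

(** The bound [#|S| <= b] turns the count outside [C] into an inclusion: all the
    neighbours of a vertex outside [C] are in [C]. *)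
Lemma regular_set_nbr_out (gT : finGroupType) (S C : {set gT}) (a b : nat)
    (v s : gT) :
  regular_set (Cay S) a b C -> #|S| <= b ->
  v \notin C -> s \in S -> v * s \in C.
Proof.
case=> _ _ _ outC leSb vC sS.
have sub : neighbours (Cay S) v \subset C.
  apply/setIidPl/eqP; rewrite eqEcard subsetIl outC //.
  by rewrite card_neighbours_Cay.
by apply: (subsetP sub); rewrite neighbours_Cay.
Qed.

Lemma regular_set1_uniq (gT : finGroupType) (S C : {set gT}) (b : nat)
    (v s t : gT) :
  regular_set (Cay S) 1 b C -> v \in C ->
  s \in S -> v * s \in C -> t \in S -> v * t \in C -> s = t.
Proof.
case=> _ _ inC _ vC sS vsC tS vtC.
have /eqP/cards1P[w defw] := inC v vC.
have : v * s \in [set w] by rewrite -defw inE neighbours_Cay sS.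
have : v * t \in [set w] by rewrite -defw inE neighbours_Cay tS.
by rewrite !inE => /eqP<- /eqP/mulgI.
Qed.

(** The conditions [t != s] and [t != s^-1] ensure that [v * t] is not the
    partner [v * s] of [v], and that [v * s * t] is not the partner [v] of
    [v * s]. *)
Lemma no_matched_edge_in_square (gT : finGroupType) (S C : {set gT}) (b : nat)
    (v s t : gT) :
  regular_set (Cay S) 1 b C -> #|S| <= b ->
  s \in S -> s^-1 \in S -> t \in S -> commute s t -> t != s -> t != s^-1 ->
  v \in C -> v * s \notin C.
Proof.
move=> regC leSb sS sVS tS cst t_s t_sV vC; apply/negP => vsC.
have vtC : v * t \notin C.
  apply: contra t_s => vtC; apply/eqP.
  exact: (regular_set1_uniq regC vC tS vtC sS vsC).
have vtsC := regular_set_nbr_out regC leSb vtC sS.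
rewrite -mulgA -cst mulgA in vtsC.
have vssVC : v * s * s^-1 \in C by rewrite mulgK.
by case/eqP: t_sV; apply: (regular_set1_uniq regC vsC tS vtsC sVS vssVC).
Qed.

Lemma card_circ_set (gT : finGroupType) (x : gT) (k l : nat) :
  #|circ_set x k l| <= 4.
Proof.
have -> : #|circ_set x k l| = #|[:: x ^+ k; x ^- k; x ^+ l; x ^- l]|.
  by apply: eq_card => y; rewrite !inE -!orbA.
exact: card_size.
Qed.

(** Quarticity gives two disjoint pairs of mutually inverse generators; the pair
    not containing [s] supplies the second direction of the 4-cycle. *)
Lemma circ_set_other (gT : finGroupType) (x : gT) (k l : nat) (s : gT) :
  circ_quartic x k l -> s \in circ_set x k l ->
  exists t, [/\ t \in circ_set x k l, commute s t, t != s & t != s^-1].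
Proof.
rewrite /circ_quartic /= !inE !negb_or -!andbA.
case/and5P=> _ _ _ _ /and5P[_ kl klV kVl /and3P[kVlV _ _]].
have ckl : commute (x ^+ k) (x ^+ l) by apply/commuteX2.
have clk := commute_sym ckl.
have ckVl : commute (x ^- k) (x ^+ l) by apply/commute_sym/commuteV.
have clVk : commute (x ^- l) (x ^+ k) by apply/commute_sym/commuteV.
rewrite -!orbA => /or4P[] /eqP->;
  [exists (x ^+ l) | exists (x ^+ l) | exists (x ^+ k) | exists (x ^+ k)];
  by split; rewrite ?invgK ?inE ?eqxx ?orbT // eq_sym.
Qed.

Theorem corollary5p2 (gT : finGroupType) (x : gT) (n k l : nat)
  (n_gt0 : 0 < n) (k_gt0 : 0 < k) (l_gt0 : 0 < l)
  (gT_gen : [set: gT] = <[x]>) (x_order : #[x] = n)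
  (quartic : circ_quartic x k l)
  (conn : connected_graph (Cay (circ_set x k l))) :
  ~ exists C : {set gT}, regular_set (Cay (circ_set x k l)) 1 4 C.
Proof.
case=> C regC; have [/set0Pn[v vC] _ inC _] := regC.
have /eqP/cards1P[w defw] := inC v vC.
have : w \in neighbours (Cay (circ_set x k l)) v :&: C by rewrite defw set11.
rewrite -(mulKVg v w) inE neighbours_Cay => /andP[sS].
have [t [tS cst t_s t_sV]] := circ_set_other quartic sS.
have sVS := circ_set_inv sS.
exact/negP/(no_matched_edge_in_square regC (card_circ_set x k l) sS sVS tS cst).
Qed.
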